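(* (1) Let $\psi:R\to S$ be a centralizing $G$-Galois extension. Then its Galois element $X=\eta_e=\sum_{i=1}^m x_i\otimes y_i\in S\otimes_RS$ verifies the Frobenius-separability equation $$X_{12}X_{23}=X_{23}X_{13}=X_{13}X_{12}$$ in $S\otimes_RS\otimes_RS$, and therefore the Yang-Baxter equation $X_{12}X_{23}X_{12}=X_{23}X_{12}X_{23}$. (2) Let $\psi:R\to S$ be a $G$-Galois-Azumaya extension. Then the Galois element $\eta_e$ is invertible in $S\otimes_RS$, hence defines for any integer $n\ge 2$ a representation $\rho_\psi^n:B_n\to\mathrm{Aut}(S^{\otimes_R n})$ of the braid group $B_n$.
   Context: Fix a commutative ring $k$; ''algebra'' means associative unital $k$-algebra. If a finite group $G$ acts by ring automorphisms on an algebra $S$, let $S(G)$ be the algebra of all maps $G\to S$ with pointwise operations, a free left $S$-module with basis the Dirac functions $\delta_g$ ($g\in G$). A $G$-Galois extension is a morphism of algebras $\psi:R\to S$ together with a finite group $G$ acting by ring automorphisms on $S$, trivially on $\psi(R)$, such that $S$ is faithfully flat as a left $R$-module via $\psi$ and $\Gamma:S\otimes_RS\to S(G)$, $\Gamma(s\otimes t)=\sum_{g\in G}s\,g(t)\,\delta_g$, is an isomorphism. Its Galois element is $\eta_e=\Gamma^{-1}(\delta_e)\in S\otimes_RS$, where $e$ is the neutral element of $G$. The extension is centralizing if $\psi$ embeds $R$ in the centre of $S$ (so $R$ is commutative and $S$ is an $R$-algebra); it is $G$-Galois-Azumaya if $R$ is commutative and $S$ is an Azumaya (i.e. central separable) $R$-algebra.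 For $R$ commutative, $S$ an $R$-algebra, and $X=\sum_i x_i\otimes y_i\in S\otimes_RS$, put in the tensor product algebra $S\otimes_RS\otimes_RS$ (factorwise multiplication): $X_{12}=\sum_ix_i\otimes y_i\otimes1$, $X_{23}=\sum_i1\otimes x_i\otimes y_i$, $X_{13}=\sum_ix_i\otimes1\otimes y_i$. $B_n$ is Artin's braid group on $n$ strings: generators $\sigma_1,\dots,\sigma_{n-1}$, relations $\sigma_i\sigma_j=\sigma_j\sigma_i$ for $|i-j|>1$ and $\sigma_{i+1}\sigma_i\sigma_{i+1}=\sigma_i\sigma_{i+1}\sigma_i$ for $1\le i<n-1$. $\mathrm{Aut}$ denotes $R$-module automorphisms. *)

(* Defs.v *)
From HB Require Import structures.
From mathcomp Require Import all_boot all_order all_fingroup all_algebra.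
From mathcomp Require Import generic_quotient boolp classical_sets.

Set Implicit Arguments.
Unset Strict Implicit.
Unset Printing Implicit Defensive.

Import GRing.Theory.
Local Open Scope ring_scope.
Local Open Scope quotient_scope.

(* [M (x)_R N] for a right module [M] and a left module [N].  The actions [ra]
   and [la] are explicit, because [S] is used with the two actions induced by a
   ring morphism [R -> S].  A finite formal sum of pairs [(m, n)] is a list, and
   [M (x)_R N] is the quotient of the monoid of lists by the congruence
   generated by commutativity, biadditivity and [(m r, n) ~ (m, r n)].  The
   rule [tens_zero] is what makes [(- m, n)] opposite to [(m, n)]. *)

Section Tensor.
Variables (R : Type) (M N : zmodType) (ra : M -> R -> M) (la : R -> N -> N).

Inductive tens_rel : seq (M * N) -> seq (M * N) -> Prop :=
| tens_refl s : tens_rel s s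
| tens_sym s t : tens_rel s t -> tens_rel t s
| tens_trans s t u : tens_rel s t -> tens_rel t u -> tens_rel s u
| tens_cat s s' t t' :
    tens_rel s s' -> tens_rel t t' -> tens_rel (s ++ t) (s' ++ t')
| tens_catC s t : tens_rel (s ++ t) (t ++ s)
| tens_zero n : tens_rel [:: (0, n)] [::]
| tens_addl m m' n : tens_rel [:: (m + m', n)] [:: (m, n); (m', n)]
| tens_addr m n n' : tens_rel [:: (m, n + n')] [:: (m, n); (m, n')]
| tens_bal m r n : tens_rel [:: (ra m r, n)] [:: (m, la r n)].

Definition tens_relb (s t : seq (M * N)) : bool := `[< tens_rel s t >].

Lemma tens_relb_refl : reflexive tens_relb.
Proof. by move=> s; apply/asboolP/tens_refl. Qed.

Lemma tens_relb_sym : symmetric tens_relb.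
Proof. by move=> s t; apply/asboolP/asboolP; apply: tens_sym. Qed.

Lemma tens_relb_trans : transitive tens_relb.
Proof.
by move=> t s u /asboolP st /asboolP tu; apply/asboolP/(tens_trans st tu).
Qed.

Canonical tens_equiv :=
  EquivRel tens_relb tens_relb_refl tens_relb_sym tens_relb_trans.

Definition tens : Type := {eq_quot tens_equiv}.

HB.instance Definition _ := Choice.on tens.

Definition tens_cls (s : seq (M * N)) : tens := \pi_({eq_quot tens_equiv}) s.
Definition tens_repr (x : tens) : seq (M * N) :=
  repr (x : {eq_quot tens_equiv}).

Lemma tens_reprK : cancel tens_repr tens_cls.
Proof. by move=> x; apply: reprK. Qed.

Lemma tens_eq s t : tens_rel s t -> tens_cls s = tens_cls t.
Proof. by move=> st; apply/eqmodP/asboolP. Qed.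

Lemma tens_rel_repr s : tens_rel (tens_repr (tens_cls s)) s.
Proof. by apply/asboolP; have /eqmodP := tens_reprK (tens_cls s). Qed.

Definition tens_z : tens := tens_cls [::].
Definition tens_a (x y : tens) : tens :=
  tens_cls (tens_repr x ++ tens_repr y).
Definition tens_o (x : tens) : tens :=
  tens_cls [seq (- p.1, p.2) | p <- tens_repr x].

Lemma tens_aE s t : tens_a (tens_cls s) (tens_cls t) = tens_cls (s ++ t).
Proof. by apply/tens_eq/tens_cat; apply: tens_rel_repr. Qed.

Fact tens_aA : associative tens_a.
Proof.
move=> x y z; rewrite -[x]tens_reprK -[y]tens_reprK -[z]tens_reprK.
by rewrite !tens_aE catA.
Qed.

Fact tens_aC : commutative tens_a.
Proof. by move=> x y; apply/tens_eq/tens_catC. Qed.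

Fact tens_a0 : left_id tens_z tens_a.
Proof. by move=> x; rewrite -[x]tens_reprK tens_aE. Qed.

Lemma tens_rel_opp s : tens_rel ([seq (- p.1, p.2) | p <- s] ++ s) [::].
Proof.
elim: s => [|[m n] s IHs] /=; first exact: tens_refl.
set s' := map _ s.
apply: (@tens_trans _ ([:: (- m, n)] ++ [:: (m, n)] ++ (s' ++ s))).
  rewrite -cat1s; apply: tens_cat; first exact: tens_refl.
  rewrite -[(m, n) :: s]cat1s !catA.
  by apply: tens_cat; [apply: tens_catC | apply: tens_refl].
rewrite catA -[[::]]cats0; apply: tens_cat IHs.
apply: tens_trans (tens_zero n); apply: tens_sym.
by rewrite -(addNr m); apply: tens_addl.
Qed.

Fact tens_aN : left_inverse tens_z tens_o tens_a.
Proof.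
move=> x; rewrite -[X in tens_a _ X]tens_reprK tens_aE.
exact/tens_eq/tens_rel_opp.
Qed.

HB.instance Definition _ := GRing.isZmodule.Build tens
  tens_aA tens_aC tens_a0 tens_aN.

Definition pure (m : M) (n : N) : tens := tens_cls [:: (m, n)].

Lemma pureDl m m' n : pure (m + m') n = pure m n + pure m' n.
Proof. by rewrite /pure [RHS]tens_aE; apply/tens_eq/tens_addl. Qed.

Lemma pureDr m n n' : pure m (n + n') = pure m n + pure m n'.
Proof. by rewrite /pure [RHS]tens_aE; apply/tens_eq/tens_addr. Qed.

Lemma pure_bal m r n : pure (ra m r) n = pure m (la r n).
Proof. exact/tens_eq/tens_bal. Qed.

Lemma tens_sumE (x : tens) : x = \sum_(p <- tens_repr x) pure p.1 p.2.
Proof.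
rewrite -[LHS]tens_reprK.
elim: (tens_repr x) => [|[m n] s IHs]; first by rewrite big_nil.
by rewrite big_cons -IHs [RHS]tens_aE.
Qed.

Lemma tens_ind (P : tens -> Prop) :
  P 0 -> (forall m n x, P x -> P (pure m n + x)) -> forall x, P x.
Proof.
move=> P0 PD x; rewrite (tens_sumE x).
by elim: (tens_repr x) => [|p s IHs]; rewrite ?big_nil // big_cons; apply: PD.
Qed.

(* The universal property: [tens_lift b] is the additive map sending
   [pure m n] to [b m n]; it is meaningful only if [b] is [balanced]. *)
Variable (P : zmodType).

Definition balanced (b : M -> N -> P) : Prop :=
  [/\ forall m m' n, b (m + m') n = b m n + b m' n,
      forall m n n', b m (n + n') = b m n + b m n' &
      forall m r n, b (ra m r) n = b m (la r n)].

Definition tens_lift (b : M -> N -> P) (x : tens) : P :=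
  \sum_(p <- tens_repr x) b p.1 p.2.

Section Lift.
Variables (b : M -> N -> P) (bP : balanced b).

Lemma tens_rel_sum s t : tens_rel s t ->
  \sum_(p <- s) b p.1 p.2 = \sum_(p <- t) b p.1 p.2.
Proof.
have [bDl bDr bb] := bP.
have b0 n : b 0 n = 0 by apply: (addrI (b 0 n)); rewrite -bDl !addr0.
elim=> //=.
- by move=> ? ? ? _ -> _ ->.
- by move=> ? ? ? ? _ e _ e'; rewrite !big_cat e e'.
- by move=> ? ?; rewrite !big_cat /= addrC.
- by move=> n; rewrite big_seq1 big_nil b0.
- by move=> m m' n; rewrite !big_cons !big_nil !addr0 bDl.
- by move=> m n n'; rewrite !big_cons !big_nil !addr0 bDr.
- by move=> m r n; rewrite !big_seq1 bb.
Qed.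

Lemma tens_lift_pi s : tens_lift b (tens_cls s) = \sum_(p <- s) b p.1 p.2.
Proof. exact/tens_rel_sum/tens_rel_repr. Qed.

Lemma tens_lift_pure m n : tens_lift b (pure m n) = b m n.
Proof. by rewrite tens_lift_pi big_seq1. Qed.

Lemma tens_liftD : {morph tens_lift b : x y / x + y}.
Proof. by move=> x y; rewrite [LHS]tens_lift_pi big_cat. Qed.

Lemma tens_lift0 : tens_lift b 0 = 0.
Proof. by rewrite [LHS]tens_lift_pi big_nil. Qed.

End Lift.
End Tensor.

Arguments pure {R M N} ra la m n.

Definition central (R S : pzRingType) (psi : R -> S) : Prop :=
  forall r s, psi r * s = s * psi r.

(* Associative unital algebras over [K]; the zero algebra is allowed (it is
   excluded by [algType]).  The base ring need not be commutative by typing: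
   this lets a ring [R] whose commutativity is only a hypothesis, or only a
   consequence of one, serve as a base ring. *)
Record algebra (K : pzRingType) := Algebra {
  alg_ring :> pzRingType;
  alg_map : {rmorphism K -> alg_ring};
  alg_central : central alg_map }.

Definition rmap_act (R S : pzRingType) (f : R -> S) (s : S) (r : R) : S :=
  s * f r.
Definition lmap_act (R S : pzRingType) (f : R -> S) (r : R) (s : S) : S :=
  f r * s.

(* [S (x)_R T] for ring morphisms [f : R -> S] and [g : R -> T]. *)
Notation tensR f g := (tens (rmap_act f) (lmap_act g)).
Notation pureR f g := (pure (rmap_act f) (lmap_act g)).

Section TensorAlgebra.
Variables (K : pzRingType) (A B : algebra K).

Definition atens : Type := tensR (alg_map A) (alg_map B).
HB.instance Definition _ := GRing.Zmodule.on atens.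

Definition apure (a : A) (b : B) : atens :=
  pureR (alg_map A) (alg_map B) a b.

Lemma apureDl a a' b : apure (a + a') b = apure a b + apure a' b.
Proof. exact: pureDl. Qed.

Lemma apureDr a b b' : apure a (b + b') = apure a b + apure a b'.
Proof. exact: pureDr. Qed.

Lemma apure_bal a r b : apure (a * alg_map A r) b = apure a (alg_map B r * b).
Proof. exact: pure_bal. Qed.

Lemma apure_ind (P : atens -> Prop) :
  P 0 -> (forall a b x, P x -> P (apure a b + x)) -> forall x, P x.
Proof. exact: tens_ind. Qed.

Definition amulr (a : A) (b : B) : atens -> atens :=
  tens_lift (fun a' b' => apure (a * a') (b * b')).

Definition amul (x y : atens) : atens := tens_lift (fun a b => amulr a b y) x.

Definition aone : atens := apure 1 1.

Lemma amulr_bal a b :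
  balanced (rmap_act (alg_map A)) (lmap_act (alg_map B))
    (fun a' b' => apure (a * a') (b * b')).
Proof.
split=> [m m' n|m n n'|m r n].
- by rewrite mulrDr apureDl.
- by rewrite mulrDr apureDr.
- rewrite /rmap_act /lmap_act mulrA apure_bal; congr apure.
  by rewrite !mulrA (alg_central (a := B)).
Qed.

Lemma amulr_pure a b a' b' :
  amulr a b (apure a' b') = apure (a * a') (b * b').
Proof. exact: (tens_lift_pure (amulr_bal a b)). Qed.

Lemma amulrD a b : {morph amulr a b : x y / x + y}.
Proof. exact: (tens_liftD (amulr_bal a b)). Qed.

Lemma amulr0 a b : amulr a b 0 = 0.
Proof. exact: (tens_lift0 (amulr_bal a b)). Qed.

Lemma amul_bal y :
  balanced (rmap_act (alg_map A)) (lmap_act (alg_map B))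
    (fun a b => amulr a b y).
Proof.
split=> [m m' n|m n n'|m r n].
- elim/apure_ind: y => [|a b y IHy]; first by rewrite !amulr0 addr0.
  by rewrite !amulrD !amulr_pure IHy mulrDl apureDl addrACA.
- elim/apure_ind: y => [|a b y IHy]; first by rewrite !amulr0 addr0.
  by rewrite !amulrD !amulr_pure IHy mulrDl apureDr addrACA.
- elim/apure_ind: y => [|a b y IHy]; first by rewrite !amulr0.
  rewrite !amulrD !amulr_pure IHy; congr (_ + _).
  rewrite /rmap_act /lmap_act -mulrA (alg_central (a := A)) mulrA apure_bal.
  by rewrite mulrA.
Qed.

Lemma amulDl : left_distributive amul +%R.
Proof. by move=> x y z; apply: (tens_liftD (amul_bal z)). Qed.

Lemma amul0l y : amul 0 y = 0.
Proof. exact: (tens_lift0 (amul_bal y)). Qed.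

Lemma amul_purel a b y : amul (apure a b) y = amulr a b y.
Proof. exact: (tens_lift_pure (amul_bal y)). Qed.

Lemma amulDr : right_distributive amul +%R.
Proof.
move=> x y z; elim/apure_ind: x => [|a b x IHx]; first by rewrite !amul0l addr0.
by rewrite !amulDl IHx !amul_purel amulrD addrACA.
Qed.

Lemma amul0r x : amul x 0 = 0.
Proof. by apply: (addrI (amul x 0)); rewrite -amulDr !addr0. Qed.

Lemma amul_pure a b a' b' :
  amul (apure a b) (apure a' b') = apure (a * a') (b * b').
Proof. by rewrite amul_purel amulr_pure. Qed.

Fact amulA : associative amul.
Proof.
move=> x y z.
elim/apure_ind: x => [|a b x IHx]; first by rewrite !amul0l.
rewrite !amulDl {}IHx; congr (_ + _).
elim/apure_ind: y => [|a' b' y IHy]; first by rewrite !(amul0l, amul0r).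
rewrite !(amulDl, amulDr) {}IHy; congr (_ + _).
elim/apure_ind: z => [|a'' b'' z IHz]; first by rewrite !amul0r.
by rewrite !amulDr {}IHz !amul_pure !mulrA.
Qed.

Fact amul1l : left_id aone amul.
Proof.
move=> x; elim/apure_ind: x => [|a b x IHx]; first by rewrite amul0r.
by rewrite amulDr IHx amul_pure !mul1r.
Qed.

Fact amul1r : right_id aone amul.
Proof.
move=> x; elim/apure_ind: x => [|a b x IHx]; first by rewrite amul0l.
by rewrite amulDl IHx amul_pure !mulr1.
Qed.

HB.instance Definition _ := GRing.Zmodule_isPzRing.Build atens
  amulA amul1l amul1r amulDl amulDr.

Lemma apureM a b a' b' :
  apure a b * apure a' b' = apure (a * a') (b * b').
Proof. exact: amul_pure. Qed.

Definition amap (r : K) : atens := apure (alg_map A r) 1.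

Lemma amapE r : amap r = apure 1 (alg_map B r).
Proof. by rewrite /amap -[alg_map A r]mul1r apure_bal mulr1. Qed.

Fact amap_is_additive : zmod_morphism amap.
Proof.
move=> r s; apply/eqP; rewrite eq_sym subr_eq; apply/eqP.
by rewrite /amap -apureDl -rmorphD subrK.
Qed.

Fact amap_is_multiplicative : monoid_morphism amap.
Proof.
by split=> [|r s]; rewrite /amap ?rmorph1 // rmorphM apureM mulr1.
Qed.

HB.instance Definition _ := GRing.isZmodMorphism.Build K atens amap
  amap_is_additive.
HB.instance Definition _ := GRing.isMonoidMorphism.Build K atens amap
  amap_is_multiplicative.

Fact amap_central : central amap.
Proof.
move=> r; elim/apure_ind => [|a b x IHx]; first by rewrite mulr0 mul0r.
rewrite mulrDl mulrDr IHx; congr (_ + _).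
by rewrite /amap !apureM mul1r mulr1 (alg_central (a := A)).
Qed.

Definition tens_alg : algebra K := Algebra amap_central.

End TensorAlgebra.

(* [tpow A m] is the tensor power with [m.+1] factors, bracketed to the left,
   and [ptens m a] is [a 0 (x) ... (x) a m]. *)

Fixpoint tpow (K : pzRingType) (A : algebra K) (m : nat) : algebra K :=
  if m is m'.+1 then tens_alg (tpow A m') A else A.

Fixpoint ptens (K : pzRingType) (A : algebra K) (m : nat) (a : nat -> A) :
    tpow A m :=
  match m with
  | 0 => a 0%N
  | m'.+1 => apure (ptens m' a) (a m'.+1)
  end.

(* For [X = \sum_k x_k (x) y_k], [leg m i j X] is the element [X_{ij}] of the
   [m.+1]-fold tensor power: the sum of the pure tensors with [x_k] in place
   [i], [y_k] in place [j] and [1] elsewhere.  Places are counted from [0]. *)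
Definition leg (K : pzRingType) (A : algebra K) (m i j : nat) (X : tpow A 1) :
    tpow A m :=
  tens_lift (fun x y => ptens m (fun l => if l == i then x
                                          else if l == j then y else 1)) X.

Section Leg.
Variables (K : pzRingType) (A : algebra K).

Lemma eq_ptens m (a a' : nat -> A) :
  (forall l, (l <= m)%N -> a l = a' l) -> ptens m a = ptens m a'.
Proof.
elim: m => [|m IHm] aa' /=; first exact: aa'.
by rewrite aa' // IHm // => l lm; apply/aa'/ltnW.
Qed.

Definition put (a : nat -> A) i x l := if l == i then x else a l.

Lemma ptensD m i (a : nat -> A) x y : (i <= m)%N ->
  ptens m (put a i (x + y)) = ptens m (put a i x) + ptens m (put a i y).
Proof.
elim: m => [|m IHm] /=; first by rewrite leqn0 => /eqP ->.
rewrite leq_eqVlt => /predU1P[-> | lt_im].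
  rewrite /put eqxx apureDr; congr (apure _ _ + apure _ _); apply: eq_ptens;
  by move=> l lm; rewrite (ltn_eqF (leq_ltn_trans lm (ltnSn m))).
by rewrite {2 4 6}/put (gtn_eqF lt_im) IHm // apureDl.
Qed.

Lemma ptens_map m i (a : nat -> A) r x : (i <= m)%N ->
  ptens m (put a i (alg_map A r * x)) =
  alg_map (tpow A m) r * ptens m (put a i x).
Proof.
elim: m => [|m IHm] /=; first by rewrite leqn0 => /eqP ->.
rewrite leq_eqVlt => /predU1P[-> | lt_im].
  rewrite [amap _ _ _]amapE apureM mul1r.
  rewrite {2 4}/put eqxx; congr apure; apply: eq_ptens => l lm.
  by rewrite /put (ltn_eqF (leq_ltn_trans lm (ltnSn m))).
by rewrite {2 4}/put (gtn_eqF lt_im) IHm // apureM mul1r.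
Qed.

Lemma leg_bal m i j : (i <= m)%N -> (j <= m)%N -> i != j ->
  balanced (rmap_act (alg_map A)) (lmap_act (alg_map A))
    (fun x y => ptens m (fun l => if l == i then x
                                  else if l == j then y else 1)).
Proof.
move=> im jm neq_ij.
have Ei x y : ptens m (fun l => if l == i then x else if l == j then y else 1)
    = ptens m (put (put (fun=> 1) j y) i x) by [].
have Ej x y : ptens m (fun l => if l == i then x else if l == j then y else 1)
    = ptens m (put (put (fun=> 1) i x) j y).
  apply: eq_ptens => l _; rewrite /put.
  by case: eqP => // ->; rewrite (negPf neq_ij).
split=> [x x' y|x y y'|x r y].
- by rewrite !Ei ptensD.
- by rewrite !Ej ptensD.
- rewrite /rmap_act /lmap_act -(alg_central (a := A)).
  rewrite [LHS](Ei (alg_map A r * x) y) [RHS](Ej x (alg_map A r * y)).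
  by rewrite !ptens_map // -Ei -Ej.
Qed.

Lemma leg_pure m i j (x y : A) : (i <= m)%N -> (j <= m)%N -> i != j ->
  leg m i j (apure x y : tpow A 1) =
  ptens m (fun l => if l == i then x else if l == j then y else 1).
Proof. by move=> im jm ij; exact: (tens_lift_pure (leg_bal im jm ij)). Qed.

Lemma legD m i j : (i <= m)%N -> (j <= m)%N -> i != j ->
  {morph @leg K A m i j : X Y / X + Y}.
Proof. by move=> im jm ij; exact: (tens_liftD (leg_bal im jm ij)). Qed.

End Leg.

Section Galois.
Variables (R S : pzRingType) (psi : {rmorphism R -> S}).

(* [f (x)_R S] for an [R]-linear map [f] of right [R]-modules. *)
Definition mod_act (M : lmodType R^c) (m : M) (r : R) : M := (r : R^c) *: m.

Definition tens_map (M M' : lmodType R^c) (f : M -> M') :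
    tens (@mod_act M) (lmap_act psi) -> tens (@mod_act M') (lmap_act psi) :=
  tens_lift (fun m s => pure (@mod_act M') (lmap_act psi) (f m) s).

Lemma tens_map_pure (M M' : lmodType R^c) (f : {linear M -> M'}) m s :
  tens_map f (pure (@mod_act M) (lmap_act psi) m s) =
  pure (@mod_act M') (lmap_act psi) (f m) s.
Proof.
apply: tens_lift_pure; split=> [m1 m2 n|m1 n n'|m1 r n].
- by rewrite raddfD pureDl.
- by rewrite pureDr.
- by rewrite -pure_bal /mod_act linearZ.
Qed.

Definition exact (M M' M'' : zmodType) (f : M -> M') (g : M' -> M'') : Prop :=
  forall y, g y = 0 <-> exists x, f x = y.

Definition faithfully_flat : Prop :=
  forall (M M' M'' : lmodType R^c) (f : {linear M -> M'})
    (g : {linear M' -> M''}),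
  exact f g <-> exact (tens_map f) (tens_map g).

Variables (G : finGroupType) (act : G -> {rmorphism S -> S}).

(* [S(G)] is [{ffun G -> S}]. *)
Definition Gamma : tensR psi psi -> {ffun G -> S} :=
  tens_lift (fun s t => [ffun g => s * act g t]).

Definition dirac (h : G) : {ffun G -> S} := [ffun g => if g == h then 1 else 0].

Record galois_extension : Prop := GaloisExtension {
  galois_act1 : forall s, act 1%g s = s;
  galois_actM : forall g h s, act (g * h)%g s = act g (act h s);
  galois_fix : forall g r, act g (psi r) = psi r;
  galois_flat : faithfully_flat;
  galois_bij : bijective Gamma }.

Lemma Gamma_pure s t : (forall g r, act g (psi r) = psi r) ->
  Gamma (pureR psi psi s t) = [ffun g => s * act g t].
Proof.
move=> psi_fix; apply: tens_lift_pure; split=> [m m' n|m n n'|m r n].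
- by apply/ffunP=> g; rewrite !ffunE mulrDl.
- by apply/ffunP=> g; rewrite !ffunE rmorphD mulrDr.
- apply/ffunP=> g; rewrite !ffunE /rmap_act /lmap_act.
  by rewrite rmorphM psi_fix mulrA.
Qed.

(* [Gamma^-1 (dirac 1)] when [Gamma] is bijective. *)
Definition galois_element : tensR psi psi :=
  xget 0 [set X | Gamma X = dirac 1%g].

Lemma Gamma_galois_element : galois_extension ->
  Gamma galois_element = dirac 1%g.
Proof.
case=> _ _ _ _ [Gi GK GiK]; rewrite /galois_element.
exact: (@xgetPex _ 0 [set X | Gamma X = dirac 1%g] (ex_intro _ _ (GiK _))).
Qed.

Record centralizing_galois : Prop := CentralizingGalois {
  cgalois_galois : galois_extension;
  cgalois_inj : injective psi;
  cgalois_central : central psi }.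

Definition bimod_l (s : S) : tensR psi psi -> tensR psi psi :=
  tens_lift (fun x y => pureR psi psi (s * x) y).
Definition bimod_r (s : S) : tensR psi psi -> tensR psi psi :=
  tens_lift (fun x y => pureR psi psi x (y * s)).
Definition mult : tensR psi psi -> S := tens_lift (fun x y => x * y).

Lemma bimod_l_pure s x y :
  bimod_l s (pureR psi psi x y) = pureR psi psi (s * x) y.
Proof.
apply: tens_lift_pure; split=> [m m' n|m n n'|m r n].
- by rewrite mulrDr pureDl.
- by rewrite pureDr.
- by rewrite {1}/rmap_act mulrA pure_bal.
Qed.

Lemma bimod_r_pure s x y :
  bimod_r s (pureR psi psi x y) = pureR psi psi x (y * s).
Proof.
apply: tens_lift_pure; split=> [m m' n|m n n'|m r n].
- by rewrite pureDl.
- by rewrite mulrDl pureDr.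
- by rewrite pure_bal /lmap_act mulrA.
Qed.

Lemma mult_pure x y : mult (pureR psi psi x y) = x * y.
Proof.
apply: tens_lift_pure; split=> [m m' n|m n n'|m r n].
- by rewrite mulrDl.
- by rewrite mulrDr.
- by rewrite /rmap_act /lmap_act mulrA.
Qed.

(* The multiplication of [S] splits as a morphism of [S]-[S]-bimodules. *)
Definition separable_ext : Prop :=
  exists sec : S -> tensR psi psi,
    [/\ {morph sec : x y / x + y},
        forall s x, sec (s * x) = bimod_l s (sec x),
        forall s x, sec (x * s) = bimod_r s (sec x) &
        forall x, mult (sec x) = x].

(* Central means that [psi] is an isomorphism of [R] onto the centre of [S]. *)
Record azumaya : Prop := Azumaya {
  azumaya_inj : injective psi;
  azumaya_central : central psi;
  azumaya_center : forall s, (forall t, s * t = t * s) -> exists r, psi r = s;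
  azumaya_separable : separable_ext }.

Record galois_azumaya : Prop := GaloisAzumaya {
  gazumaya_galois : galois_extension;
  gazumaya_comm : commutative (@GRing.mul R);
  gazumaya_azumaya : azumaya }.

Definition gazumaya_central (H : galois_azumaya) : central psi :=
  azumaya_central (gazumaya_azumaya H).

End Galois.

(* The braid group is the quotient of the words in the letters [(b, i)], with
   [i : 'I_n.-1] counted from [0]; [(b, i)] stands for the generator [sigma i]
   if [b] is [true] and for its inverse otherwise. *)

Section Braid.
Variable n : nat.

Definition braid_word := seq (bool * 'I_n.-1).

Inductive braid_rel : braid_word -> braid_word -> Prop :=
| braid_refl s : braid_rel s s
| braid_sym s t : braid_rel s t -> braid_rel t s
| braid_trans s t u : braid_rel s t -> braid_rel t u -> braid_rel s u
| braid_cat s s' t t' :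
    braid_rel s s' -> braid_rel t t' -> braid_rel (s ++ t) (s' ++ t')
| braid_inv b i : braid_rel [:: (b, i); (~~ b, i)] [::]
| braid_comm (i j : 'I_n.-1) : (i.+1 < j)%N || (j.+1 < i)%N ->
    braid_rel [:: (true, i); (true, j)] [:: (true, j); (true, i)]
| braid_artin (i j : 'I_n.-1) : j = i.+1 :> nat ->
    braid_rel [:: (true, j); (true, i); (true, j)]
              [:: (true, i); (true, j); (true, i)].

Definition braid_relb (s t : braid_word) : bool := `[< braid_rel s t >].

Lemma braid_relb_refl : reflexive braid_relb.
Proof. by move=> s; apply/asboolP/braid_refl. Qed.

Lemma braid_relb_sym : symmetric braid_relb.
Proof. by move=> s t; apply/asboolP/asboolP; apply: braid_sym. Qed.

Lemma braid_relb_trans : transitive braid_relb.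
Proof.
by move=> t s u /asboolP st /asboolP tu; apply/asboolP/(braid_trans st tu).
Qed.

Canonical braid_equiv :=
  EquivRel braid_relb braid_relb_refl braid_relb_sym braid_relb_trans.

Definition braid : Type := {eq_quot braid_equiv}.

HB.instance Definition _ := Choice.on braid.

Definition braid_cls (s : braid_word) : braid :=
  \pi_({eq_quot braid_equiv}) s.
Definition braid_repr (x : braid) : braid_word :=
  repr (x : {eq_quot braid_equiv}).

Lemma braid_reprK : cancel braid_repr braid_cls.
Proof. by move=> x; apply: reprK. Qed.

Lemma braid_eq s t : braid_rel s t -> braid_cls s = braid_cls t.
Proof. by move=> st; apply/eqmodP/asboolP. Qed.

Lemma braid_rel_repr s : braid_rel (braid_repr (braid_cls s)) s.
Proof. by apply/asboolP; have /eqmodP := braid_reprK (braid_cls s). Qed.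

Definition winv (s : braid_word) : braid_word :=
  rev [seq (~~ p.1, p.2) | p <- s].

Definition braid_one : braid := braid_cls [::].
Definition braid_mul (x y : braid) : braid :=
  braid_cls (braid_repr x ++ braid_repr y).
Definition braid_V (x : braid) : braid := braid_cls (winv (braid_repr x)).

Lemma braid_mulE s t :
  braid_mul (braid_cls s) (braid_cls t) = braid_cls (s ++ t).
Proof. by apply/braid_eq/braid_cat; apply: braid_rel_repr. Qed.

Fact braid_mulA : associative braid_mul.
Proof.
move=> x y z; rewrite -[x]braid_reprK -[y]braid_reprK -[z]braid_reprK.
by rewrite !braid_mulE catA.
Qed.

Fact braid_mul1g : left_id braid_one braid_mul.
Proof. by move=> x; rewrite -[x]braid_reprK braid_mulE. Qed.

Fact braid_mulg1 : right_id braid_one braid_mul.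
Proof. by move=> x; rewrite -[x]braid_reprK braid_mulE cats0. Qed.

Lemma winv_rel s : braid_rel (s ++ winv s) [::].
Proof.
elim: s => [|[b i] s IHs]; first exact: braid_refl.
have ->: ((b, i) :: s) ++ winv ((b, i) :: s)
    = [:: (b, i)] ++ (s ++ winv s) ++ [:: (~~ b, i)].
  by rewrite /winv /= rev_cons -cats1 catA.
apply: braid_trans (braid_inv b i).
rewrite -[X in braid_rel _ X]/([:: (b, i)] ++ [::] ++ [:: (~~ b, i)]).
apply: braid_cat; first exact: braid_refl.
by apply: braid_cat; last exact: braid_refl.
Qed.

Lemma winvK : involutive winv.
Proof.
move=> s; rewrite /winv map_rev revK -map_comp -[RHS]map_id.
by apply: eq_map => -[b i] /=; rewrite negbK.
Qed.

Fact braid_mulgV : right_inverse braid_one braid_V braid_mul.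
Proof.
move=> x; rewrite -[X in braid_mul X _]braid_reprK braid_mulE.
exact/braid_eq/winv_rel.
Qed.

Fact braid_mulVg : left_inverse braid_one braid_V braid_mul.
Proof.
move=> x; rewrite -[X in braid_mul _ X]braid_reprK braid_mulE.
by apply: braid_eq; rewrite -[X in _ ++ X]winvK; apply: winv_rel.
Qed.

HB.instance Definition _ := isGroup.Build braid
  braid_mulA braid_mul1g braid_mulg1 braid_mulVg braid_mulgV.

Definition sigma (i : 'I_n.-1) : braid := braid_cls [:: (true, i)].

End Braid.

(* The group of [K]-module (not algebra) automorphisms of [A], under
   composition. *)
Section Aut.
Variables (K : pzRingType) (A : algebra K).

Record mod_aut := ModAut {
  aut_fun :> A -> A;
  aut_add : {morph aut_fun : x y / x + y};
  aut_lin : forall r x, aut_fun (alg_map A r * x) = alg_map A r * aut_fun x;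
  aut_bij : bijective aut_fun }.

HB.instance Definition _ := gen_eqMixin mod_aut.
HB.instance Definition _ := gen_choiceMixin mod_aut.

Lemma mod_autP (f g : mod_aut) : f =1 g -> f = g.
Proof.
case: f g => [f fD fZ fB] [g gD gZ gB] /= /funext fg.
by case: g / fg gD gZ gB => *; congr ModAut; apply: Prop_irrelevance.
Qed.

Definition aut_one : mod_aut :=
  @ModAut idfun (fun _ _ => erefl) (fun _ _ => erefl)
    (Bijective (fun _ => erefl) (fun _ => erefl)).

Fact aut_mul_add (f g : mod_aut) : {morph f \o g : x y / x + y}.
Proof. by move=> x y /=; rewrite !aut_add. Qed.
Fact aut_mul_lin (f g : mod_aut) r x :
  (f \o g) (alg_map A r * x) = alg_map A r * (f \o g) x.
Proof. by rewrite /= !aut_lin. Qed.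

Definition aut_mul (f g : mod_aut) : mod_aut :=
  ModAut (aut_mul_add f g) (aut_mul_lin f g) (bij_comp (aut_bij f) (aut_bij g)).

Lemma aut_surj (f : mod_aut) y : exists x, f x = y.
Proof. by have [h _ hK] := aut_bij f; exists (h y). Qed.

Definition aut_invf (f : mod_aut) (y : A) : A := projT1 (cid (aut_surj f y)).

Lemma aut_invfK (f : mod_aut) : cancel (aut_invf f) f.
Proof. by move=> y; apply: projT2 (cid (aut_surj f y)). Qed.

Lemma aut_invKf (f : mod_aut) : cancel f (aut_invf f).
Proof. by move=> x; apply: (bij_inj (aut_bij f)); rewrite aut_invfK. Qed.

Fact aut_V_add (f : mod_aut) : {morph aut_invf f : x y / x + y}.
Proof.
by move=> x y; apply: (bij_inj (aut_bij f)); rewrite aut_add !aut_invfK.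
Qed.
Fact aut_V_lin (f : mod_aut) r x :
  aut_invf f (alg_map A r * x) = alg_map A r * aut_invf f x.
Proof. by apply: (bij_inj (aut_bij f)); rewrite aut_lin !aut_invfK. Qed.

Definition aut_V (f : mod_aut) : mod_aut :=
  ModAut (aut_V_add f) (aut_V_lin f) (Bijective (aut_invfK f) (aut_invKf f)).

Fact aut_mulA : associative aut_mul.
Proof. by move=> f g h; apply: mod_autP. Qed.
Fact aut_mul1g : left_id aut_one aut_mul.
Proof. by move=> f; apply: mod_autP. Qed.
Fact aut_mulg1 : right_id aut_one aut_mul.
Proof. by move=> f; apply: mod_autP. Qed.
Fact aut_mulVg : left_inverse aut_one aut_V aut_mul.
Proof. by move=> f; apply: mod_autP => x /=; apply: aut_invKf. Qed.
Fact aut_mulgV : right_inverse aut_one aut_V aut_mul.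
Proof. by move=> f; apply: mod_autP => x /=; apply: aut_invfK. Qed.

HB.instance Definition _ := isGroup.Build mod_aut
  aut_mulA aut_mul1g aut_mulg1 aut_mulVg aut_mulgV.

End Aut.

(* Main.v *)
Require Import Defs.
From HB Require Import structures.
From mathcomp Require Import all_boot all_order all_fingroup all_algebra.

Set Implicit Arguments.
Unset Strict Implicit.
Unset Printing Implicit Defensive.

Import GRing.Theory.
Local Open Scope ring_scope.

(** Write [X] for the Galois element, the sum of the [x_i (x) y_i], and [n] for
the order of [G].

The Frobenius-separability equation needs one property of [X]: it is a Casimir
element, [(s (x) 1) X = X (1 (x) s)], because both sides have image
[s delta_e] under the isomorphism [Gamma].  In a tensor power this lets a factor
[s] pass through a leg of [X] and change place ([slot_casimir]).  Moving the
factors of one leg through another leg proves the equation for any three places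
([casimir_frobenius_left], [casimir_frobenius_right]), hence the Yang-Baxter
equation and the braid relations; the other relations hold because legs with
disjoint places commute.

The substance of the second part is the invertibility of [X].  In fact
[n X^2 = 1], as for a Goldman element up to a scalar.  Let [p_g (a)] be the sum
of the [x_i a g(y_i)], and let [J_g] be the set of the [u] such that
[y u = u g(y)] for all [y]; the Casimir property says that [p_g] takes its values
in [J_g].  The trace of [S] over [G] has central values ([trace_centre]), so that
the [p_g] are the projections of a decomposition of [S] into the sum of the [J_g]
(Kanzaki); here [J_g J_h] is contained in [J_{hg}], and [J_1] is the centre, that
is [R].  It follows that the trace is [n p_1] ([trace_proj1]), and then the dual
basis formula [a = sum_i tr(a x_i) y_i] can be cut down to each [J_g]
([twisted_expand]).

The key point is that [g] is the identity on [J_g] ([act_twisted]).  Each [J_g]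
is an [R]-module of rank at most one, and locally a generator [v] satisfies
[v v = v g(v)]; the dual basis of [J_g] globalizes this argument without
localization.  It follows that [X (s (x) 1) = (1 (x) s) X] ([galois_flip]).
Together with the Casimir property this makes [X^2] commute with all [s (x) 1]
and [1 (x) s]; so [X^2] is a scalar [r] of [R], as the centre of [S (x) S] is [R]
([tensor_centre]).  Comparing the images of [X^2] at the neutral element gives
[n r = 1]. *)

(** * Legs of a tensor in a tensor power *)

Section Legs.
Variables (K : pzRingType) (A : algebra K) (m : nat).
Implicit Types (i j l : nat) (x y s : A) (X Y : tpow A 1).

Lemma ptensM p (a b : nat -> A) :
  ptens p a * ptens p b = ptens p (fun l => a l * b l).
Proof. by elim: p => //= p IHp; rewrite apureM IHp. Qed.

Lemma ptens1 p : ptens p (fun=> 1) = 1 :> tpow A p.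
Proof. by elim: p => //= p ->. Qed.

Definition slot i x : tpow A m := ptens m (put (fun=> 1) i x).

Lemma slotM i x y : slot i (x * y) = slot i x * slot i y.
Proof.
rewrite /slot ptensM; apply: eq_ptens => l _; rewrite /put.
by case: eqP => // _; rewrite mulr1.
Qed.

Lemma slot1 i : slot i 1 = 1.
Proof.
rewrite /slot -[RHS]ptens1; apply: eq_ptens => l _; rewrite /put.
by case: eqP.
Qed.

Lemma slot_comm i j x y : i != j -> GRing.comm (slot i x) (slot j y).
Proof.
move=> neq_ij; rewrite /GRing.comm /slot !ptensM; apply: eq_ptens => l _.
rewrite /put; case: eqP => [->|_]; last by rewrite mul1r mulr1.
by rewrite (negPf neq_ij) mul1r mulr1.
Qed.

Lemma leg_slot i j X : i != j ->
  leg m i j X = \sum_(p <- tens_repr X) slot i p.1 * slot j p.2.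
Proof.
move=> neq_ij; apply: eq_bigr => -[x y] _ /=; rewrite /slot ptensM.
apply: eq_ptens => l _; rewrite /put.
case: eqP => [->|_]; last by rewrite mul1r.
by rewrite (negPf neq_ij) mulr1.
Qed.

Lemma leg_apure i j x y : (i <= m)%N -> (j <= m)%N -> i != j ->
  leg m i j (apure x y : tpow A 1) = slot i x * slot j y.
Proof.
move=> im jm neq_ij; rewrite leg_pure // /slot ptensM.
apply: eq_ptens => l _; rewrite /put.
case: eqP => [->|_]; last by rewrite mul1r.
by rewrite (negPf neq_ij) mulr1.
Qed.

Lemma leg0 i j : (i <= m)%N -> (j <= m)%N -> i != j ->
  leg m i j (0 : tpow A 1) = 0.
Proof.
by move=> im jm neq_ij; apply: (addrI (leg m i j 0)); rewrite -legD // !addr0.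
Qed.

Lemma leg1 i j : (i <= m)%N -> (j <= m)%N -> i != j ->
  leg m i j (1 : tpow A 1) = 1.
Proof. by move=> im jm neq_ij; rewrite leg_apure // !slot1 mulr1. Qed.

Lemma legM i j X Y : (i <= m)%N -> (j <= m)%N -> i != j ->
  leg m i j (X * Y) = leg m i j X * leg m i j Y.
Proof.
move=> im jm neq_ij.
elim/apure_ind: X => [|x y X IHX]; first by rewrite mul0r leg0 // mul0r.
rewrite mulrDl !legD // IHX mulrDl; congr (_ + _).
elim/apure_ind: Y {IHX} => [|x' y' Y IHY]; first by rewrite mulr0 leg0 // mulr0.
rewrite mulrDr !legD // IHY mulrDr; congr (_ + _).
rewrite apureM !leg_apure // !slotM -!mulrA; congr (_ * _).
by rewrite !mulrA; congr (_ * _); apply: slot_comm.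
Qed.

Lemma slot_leg_comm l i j x X : l != i -> l != j -> i != j ->
  GRing.comm (slot l x) (leg m i j X).
Proof.
move=> li lj ij; rewrite leg_slot //; apply: commr_sum => p _.
by apply: commrM; apply: slot_comm.
Qed.

Lemma leg_comm i j i' j' X Y : i != j -> i' != j' ->
  i != i' -> i != j' -> j != i' -> j != j' ->
  GRing.comm (leg m i j X) (leg m i' j' Y).
Proof.
move=> ij ij' ? ? ? ?; apply: commr_sym; rewrite [leg m i j X]leg_slot //.
apply: commr_sum => p _.
by apply: commrM; apply: commr_sym; apply: slot_leg_comm.
Qed.

Definition casimir X : Prop :=
  forall s, (apure s 1 : tpow A 1) * X = X * apure 1 s.

Section Casimir.
Variables (X : tpow A 1) (cX : casimir X).

(** This is the Casimir property read in places [i] and [j]: a factor in place [i]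
passes through the leg and comes out in place [j]. *)
Lemma slot_casimir i j s : (i <= m)%N -> (j <= m)%N -> i != j ->
  slot i s * leg m i j X = leg m i j X * slot j s.
Proof.
move=> im jm ij; have := congr1 (leg m i j) (cX s).
by rewrite !legM // !leg_apure // !slot1 mulr1 mul1r.
Qed.

Variables (i j l : nat).
Hypotheses (im : (i <= m)%N) (jm : (j <= m)%N) (lm : (l <= m)%N).
Hypotheses (ij : i != j) (jl : j != l) (il : i != l).

(** With the first leg expanded, its factor in place [j] passes through [X_{jl}]
to place [l], while its factor in place [i] commutes with [X_{jl}]. *)
Lemma casimir_frobenius_left :
  leg m i j X * leg m j l X = leg m j l X * leg m i l X.
Proof.
rewrite [leg m i j X]leg_slot // [leg m i l X]leg_slot //.
rewrite mulr_suml mulr_sumr; apply: eq_bigr => p _.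
rewrite -mulrA slot_casimir // !mulrA; congr (_ * _).
exact: slot_leg_comm.
Qed.

(** Both sides are [X_{ij} X_{jl}]: now the second leg is expanded, and its factor
in place [j] passes back through [X_{ij}] to place [i]. *)
Lemma casimir_frobenius_right :
  leg m j l X * leg m i l X = leg m i l X * leg m i j X.
Proof.
rewrite -casimir_frobenius_left.
rewrite [leg m j l X]leg_slot // [leg m i l X]leg_slot //.
rewrite mulr_sumr mulr_suml; apply: eq_bigr => p _.
rewrite mulrA -slot_casimir // -!mulrA; congr (_ * _).
by apply: commr_sym; apply: slot_leg_comm; rewrite // eq_sym.
Qed.

Lemma casimir_yang_baxter :
  leg m i j X * leg m j l X * leg m i j X =
  leg m j l X * leg m i j X * leg m j l X.
Proof.
rewrite casimir_frobenius_left -mulrA -casimir_frobenius_right.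
by rewrite -casimir_frobenius_left mulrA.
Qed.

End Casimir.
End Legs.

(** * Representations of the braid group *)
Section BraidRepresentation.
Local Open Scope group_scope.
Variables (n : nat) (H : groupType) (s : 'I_n.-1 -> H).

Definition letter_eval (p : bool * 'I_n.-1) : H :=
  if p.1 then s p.2 else (s p.2)^-1.

Definition word_eval (w : braid_word n) : H :=
  foldr (fun p h => letter_eval p * h) 1 w.

Lemma word_eval_cat w w' : word_eval (w ++ w') = word_eval w * word_eval w'.
Proof. by elim: w => [|p w IHw] /=; rewrite ?mul1g // IHw mulgA. Qed.

Hypothesis s_comm : forall i j : 'I_n.-1, (i.+1 < j)%N -> s i * s j = s j * s i.
Hypothesis s_artin : forall i j : 'I_n.-1, j = i.+1 :> nat ->
  s j * (s i * s j) = s i * (s j * s i).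

Lemma word_eval_rel w w' : braid_rel w w' -> word_eval w = word_eval w'.
Proof.
elim=> //=.
- by move=> ? ? ? _ -> _ ->.
- by move=> ? ? ? ? _ e _ e'; rewrite !word_eval_cat e e'.
- by case=> i; rewrite /letter_eval /= mulg1 ?mulgV ?mulVg.
- by move=> i j /orP[] /s_comm e; rewrite /letter_eval /= !mulg1 e.
- by move=> i j /s_artin e; rewrite /letter_eval /= !mulg1 e.
Qed.

(** This is the universal property of the presentation of the braid group. *)
Lemma braid_representation :
  exists rho : {multiplicative braid n -> H}, forall i, rho (sigma i) = s i.
Proof.
pose f (b : braid n) := word_eval (braid_repr b).
have fM : {morph f : x y / x * y}.
  move=> x y; rewrite /f -word_eval_cat.
  exact/word_eval_rel/braid_rel_repr.
pose fC := isMultiplicative.Build _ _ f fM.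
pose rho : {multiplicative braid n -> H} := HB.pack f fC.
exists rho => i; rewrite /= /f (word_eval_rel (braid_rel_repr _)) /=.
by rewrite mulg1.
Qed.

End BraidRepresentation.

Section LeftMultiplication.
Variables (K : pzRingType) (A : algebra K).

Lemma lmul_lin (a : A) r x :
  a * (alg_map A r * x) = alg_map A r * (a * x).
Proof. by rewrite !mulrA (alg_central (a := A)). Qed.

Lemma lmul_bij (a b : A) : a * b = 1 -> b * a = 1 -> bijective ( *%R a).
Proof.
by move=> ab ba; exists ( *%R b) => x; rewrite mulrA ?ab ?ba mul1r.
Qed.

Definition lmul_aut (a b : A) (ab : a * b = 1) (ba : b * a = 1) : mod_aut A :=
  ModAut (mulrDr a) (lmul_lin a) (lmul_bij ab ba).

End LeftMultiplication.

Section CasimirBraid.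
Variables (K : pzRingType) (A : algebra K) (X Y : tpow A 1).
Hypotheses (cX : casimir X) (XY : X * Y = 1) (YX : Y * X = 1).

(** No twist of the factors is involved: the operators are the left
multiplications by [X_{i,i+1}], and the Yang-Baxter equation for legs is already
the Artin relation. *)
Lemma casimir_braid_representation n :
  exists rho : {multiplicative braid n -> mod_aut (tpow A n.-1)},
    forall (i : 'I_n.-1) (x : tpow A n.-1),
      rho (sigma i) x = leg n.-1 i i.+1 X * x.
Proof.
set m := n.-1.
have im (i : 'I_m) : (i <= m)%N by apply: ltnW.
have neqS i : i != i.+1 by rewrite (ltn_eqF (ltnSn i)).
have leg_inv (i : 'I_m) (Z Z' : tpow A 1) : Z * Z' = 1 ->
    leg m i i.+1 Z * leg m i i.+1 Z' = 1.
  by move=> ZZ'; rewrite -legM // ZZ' leg1.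
pose s i := lmul_aut (leg_inv i X Y XY) (leg_inv i Y X YX).
have s_comm (i j : 'I_m) : (i.+1 < j)%N -> (s i * s j = s j * s i)%g.
  move=> lt_ij; have [lt1 lt2] := (ltnW lt_ij, ltnW (ltnW lt_ij)).
  apply: mod_autP => x /=; rewrite !mulrA; congr (_ * x).
  apply: leg_comm; rewrite ?neqS // ltn_eqF //; exact: ltnW.
have s_artin (i j : 'I_m) : j = i.+1 :> nat ->
    (s j * (s i * s j) = s i * (s j * s i))%g.
  move=> def_j; apply: mod_autP => x /=; rewrite !mulrA; congr (_ * x).
  have lt_j := ltn_ord j; rewrite def_j in lt_j *.
  apply/esym/casimir_yang_baxter;
    by rewrite ?neqS ?(ltn_eqF (leqW (ltnSn i))) ?im ?lt_j //; apply: ltnW.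
have [rho rhoE] := braid_representation s_comm s_artin.
by exists rho => i x; rewrite rhoE.
Qed.

End CasimirBraid.

(** * The dual basis argument *)

(** If the sum of the [a] in [s] fixes [w] and every [a^2] kills [w], then [w] is
killed by a power of that sum: by commutation, each of its long monomials has a
repeated factor.  This replaces localization at the elements of a partition of
unity.  The induction first applies the result to [a w], which [a] kills, for the
head [a] of the list. *)
Lemma sum_annihilated_eq0 (S : pzRingType) (s : seq S) (w : S) :
  {in s &, forall a b, a * b = b * a} ->
  {in s, forall a, a * (a * w) = 0} -> w = \sum_(a <- s) a * w -> w = 0.
Proof.
elim: s w => [|a s IHs] w cs sw0; first by rewrite big_nil.
rewrite big_cons => def_w.
have s_as b : b \in s -> b \in a :: s by rewrite inE orbC => ->.
have cs' : {in s &, forall a b, a * b = b * a}.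
  by move=> b c sb sc; apply: cs; apply: s_as.
have aw0 : a * w = 0.
  apply: (IHs _ cs') => [b sb|].
    have ab : a * b = b * a by apply: cs; [exact: mem_head | exact: s_as].
    rewrite (mulrA b a) -ab -mulrA (mulrA b a) -ab -mulrA sw0 ?mulr0 //.
    exact: s_as.
  rewrite {1}def_w mulrDr sw0 ?mem_head // add0r mulr_sumr.
  apply: eq_big_seq => b sb; rewrite !mulrA; congr (_ * _).
  by apply: cs; [exact: mem_head | exact: s_as].
apply: (IHs _ cs') => [b /s_as/sw0 //|].
by rewrite {1}def_w aw0 add0r.
Qed.

(** * The Galois element and the projections it defines *)
Section GaloisAlgebra.
Variables (R : pzRingType) (A : algebra R) (G : finGroupType).
Variables (act : G -> {rmorphism A -> A}).
Hypothesis galA : galois_extension (alg_map A) act.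
Implicit Types (g h : G) (a s t u y z : A) (Z : tpow A 1).

Local Notation pt s t := (apure s t : tpow A 1).
Local Notation X := (galois_element (alg_map A) act : tpow A 1).

Let act1 s : act 1%g s = s. Proof. exact: (galois_act1 galA). Qed.
Let actM g h s : act (g * h)%g s = act g (act h s).
Proof. exact: (galois_actM galA). Qed.
Let act_fix g r : act g (alg_map A r) = alg_map A r.
Proof. exact: (galois_fix galA). Qed.
Let actVK g : cancel (act g^-1%g) (act g).
Proof. by move=> s; rewrite -actM mulgV act1. Qed.

Definition coord g Z : A := Gamma act (Z : atens A A) g.

Lemma coord_apure g s t : coord g (pt s t) = s * act g t.
Proof. by rewrite /coord Gamma_pure ?ffunE //; exact: act_fix. Qed.

Lemma coordD g Z Z' : coord g (Z + Z') = coord g Z + coord g Z'.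
Proof.
have bal : balanced (rmap_act (alg_map A)) (lmap_act (alg_map A))
    (fun s t => [ffun h => s * act h t]).
  split=> [s s' t|s t t'|s r t]; apply/ffunP=> h; rewrite !ffunE.
  - by rewrite mulrDl.
  - by rewrite rmorphD mulrDr.
  - by rewrite /rmap_act /lmap_act rmorphM act_fix mulrA.
by rewrite /coord /Gamma (tens_liftD bal) ffunE.
Qed.

Lemma coord0 g : coord g 0 = 0.
Proof. by apply: (addrI (coord g 0)); rewrite -coordD !addr0. Qed.

Lemma coord_inj Z Z' : (forall g, coord g Z = coord g Z') -> Z = Z'.
Proof. by move=> ZZ'; apply: (bij_inj (galois_bij galA)); apply/ffunP. Qed.

Lemma coord_galois g : coord g X = if g == 1%g then 1 else 0.
Proof. by rewrite /coord Gamma_galois_element // ffunE. Qed.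

Lemma coord_mull g s Z : coord g (pt s 1 * Z) = s * coord g Z.
Proof.
elim/apure_ind: Z => [|x y Z IHZ]; first by rewrite mulr0 coord0 mulr0.
rewrite mulrDr !coordD IHZ mulrDr; congr (_ + _).
by rewrite apureM !coord_apure mul1r mulrA.
Qed.

Lemma coord_mulr g s Z : coord g (Z * pt 1 s) = coord g Z * act g s.
Proof.
elim/apure_ind: Z => [|x y Z IHZ]; first by rewrite mul0r coord0 mul0r.
rewrite mulrDl !coordD IHZ mulrDl; congr (_ + _).
by rewrite apureM !coord_apure mulr1 rmorphM mulrA.
Qed.

(** Compare coordinates: at [g] the two sides are [s delta] and [delta g(s)],
and both vanish unless [g] is neutral, where [g(s) = s]. *)
Lemma galois_casimir : casimir X.
Proof.
move=> s; apply: coord_inj => g; rewrite coord_mull coord_mulr coord_galois.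
by case: eqP => [->|_]; rewrite ?act1 ?mulr1 ?mul1r ?mulr0 ?mul0r.
Qed.

Lemma sum_galois g :
  \sum_(p <- tens_repr X) p.1 * act g p.2 = if g == 1%g then 1 else 0.
Proof.
rewrite -coord_galois {2}(tens_sumE X).
elim: (tens_repr X) => [|p s IHs]; first by rewrite !big_nil coord0.
by rewrite !big_cons IHs coordD coord_apure.
Qed.

Definition proj g a : A := \sum_(p <- tens_repr X) p.1 * a * act g p.2.

Lemma coord_proj g a : coord g (X * pt a 1) = proj g a.
Proof.
rewrite /proj {1}(tens_sumE X).
elim: (tens_repr X) => [|p s IHs]; first by rewrite !big_nil mul0r coord0.
rewrite !big_cons -IHs mulrDl coordD; congr (_ + _).
by rewrite [pure _ _ _ _]/(apure p.1 p.2) apureM coord_apure mulr1.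
Qed.

Lemma projD g a b : proj g (a + b) = proj g a + proj g b.
Proof.
by rewrite -big_split; apply: eq_bigr => p _; rewrite mulrDr mulrDl.
Qed.

Lemma proj0 g : proj g 0 = 0.
Proof. by rewrite /proj big1 // => p _; rewrite mulr0 mul0r. Qed.

Lemma proj_sum g (I : Type) (r : seq I) (P : pred I) (F : I -> A) :
  proj g (\sum_(i <- r | P i) F i) = \sum_(i <- r | P i) proj g (F i).
Proof. exact: (big_morph _ (projD g) (proj0 g)). Qed.

Definition twisted g u : Prop := forall y, y * u = u * act g y.

Lemma proj_twisted g a : twisted g (proj g a).
Proof.
move=> y; rewrite -coord_proj -coord_mull -coord_mulr mulrA galois_casimir.
by rewrite -!mulrA !apureM !mulr1 !mul1r.
Qed.

Lemma twistedM g h u v :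
  twisted g u -> twisted h v -> twisted (h * g)%g (u * v).
Proof. by move=> ug vh y; rewrite mulrA ug -mulrA vh actM mulrA. Qed.

Lemma twistedB g u v : twisted g u -> twisted g v -> twisted g (u - v).
Proof. by move=> ug vg y; rewrite mulrBr mulrBl ug vg. Qed.

Lemma twisted_act g h u : twisted g u -> twisted (h * g * h^-1)%g (act h u).
Proof.
by move=> ug y; rewrite -{1}[y](actVK h) -rmorphM ug rmorphM !actM.
Qed.

(** Since [u h(y) = (g^-1 h)(y) u], the factor [u] can be taken out of the sum,
which becomes the coordinate at [g^-1 h] of the Galois element. *)
Lemma proj_of_twisted g h u : twisted g u ->
  proj h u = if h == g then u else 0.
Proof.
move=> ug; transitivity
  ((\sum_(p <- tens_repr X) p.1 * act (g^-1 * h)%g p.2) * u).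
  rewrite mulr_suml; apply: eq_bigr => p _.
  by rewrite -!mulrA ug -actM mulKVg.
rewrite sum_galois -(inj_eq (mulgI g)) mulKVg mulg1.
by case: eqP; rewrite ?mul1r ?mul0r.
Qed.

Definition centre z : Prop := forall y, y * z = z * y.

Lemma centre_twisted z : twisted 1 z <-> centre z.
Proof. by split=> zc y; rewrite zc act1. Qed.

Definition trace a : A := \sum_g act g a.

(** An invariant [t] satisfies [t (x) 1 = 1 (x) t], as both have the constant
image [t] under [Gamma].  Hence [p_1(t) = t], and the values of [p_1] are
central. *)
Lemma trace_centre a : centre (trace a).
Proof.
have fix_tr g : act g (trace a) = trace a.
  rewrite rmorph_sum [RHS](reindex_inj (mulgI g)) /=.
  by apply: eq_bigr => h _; rewrite actM.
have tr_bal : pt (trace a) 1 = apure 1 (trace a).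
  by apply: coord_inj => g; rewrite !coord_apure rmorph1 mulr1 mul1r fix_tr.
apply/centre_twisted; have := @proj_twisted 1 (trace a).
by rewrite -coord_proj tr_bal coord_mulr coord_galois eqxx mul1r act1.
Qed.

(** The sum over [g] of [x_i a g(y_i)] is [x_i a tr(y_i)], and the trace is
central, so that [a] can be moved to the end. *)
Lemma sum_proj a : \sum_g proj g a = a.
Proof.
rewrite exchange_big /=.
transitivity ((\sum_g \sum_(p <- tens_repr X) p.1 * act g p.2) * a).
  rewrite [in RHS]exchange_big mulr_suml; apply: eq_bigr => p _.
  transitivity (p.1 * a * trace p.2); first by rewrite mulr_sumr.
  by rewrite -mulrA trace_centre mulrA mulr_sumr.
under eq_bigr do rewrite sum_galois.
by rewrite -big_mkcond big_pred1_eq mul1r.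
Qed.

(** Of the components of [a], only [p_k(a)] with [g k g^-1 = h] contributes, as
[g] sends [J_k] to [J_{g k g^-1}]. *)
Lemma proj_act g h a : proj h (act g a) = act g (proj (h ^ g)%g a).
Proof.
rewrite -{1}(sum_proj a) rmorph_sum proj_sum.
rewrite (bigD1 (h ^ g)%g) //= big1 => [|k neq].
  rewrite (proj_of_twisted _ (twisted_act _ (@proj_twisted _ _))).
  by rewrite conjgE -!mulgA mulgV mulg1 mulKVg eqxx addr0.
rewrite (proj_of_twisted _ (twisted_act _ (@proj_twisted _ _))).
case: eqP => // def_h; case/eqP: neq.
by rewrite def_h conjgE -!mulgA mulVg mulg1 mulKg.
Qed.

(** This says that the [x_i] and [y_i] are dual bases for the trace form. *)
Lemma sum_trace a : \sum_(p <- tens_repr X) trace (a * p.1) * p.2 = a.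
Proof.
transitivity (\sum_g act g a * act g (if g^-1%g == 1%g then 1 else 0)).
  under eq_bigr do rewrite mulr_suml; rewrite exchange_big /=.
  apply: eq_bigr => g _; rewrite -sum_galois rmorph_sum mulr_sumr.
  by apply: eq_bigr => p _; rewrite !rmorphM actVK mulrA.
rewrite (bigD1 1%g) //= big1 => [|g /negPf ne1].
  by rewrite invg1 eqxx !act1 mulr1 addr0.
by rewrite -[1%g]invg1 (inj_eq invg_inj) ne1 rmorph0 mulr0.
Qed.

(** * Galois extensions whose base is the whole centre *)
Section Central.
Hypothesis centre_base : forall z, centre z -> exists r, alg_map A r = z.

Lemma act_centre g z : centre z -> act g z = z.
Proof. by case/centre_base=> r <-. Qed.

Lemma proj_mulc g z a : centre z -> proj g (z * a) = z * proj g a.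
Proof.
move=> zc; rewrite mulr_sumr; apply: eq_bigr => p _.
by rewrite !mulrA zc.
Qed.

Lemma proj1_centre a : centre (proj 1 a).
Proof. exact/centre_twisted/proj_twisted. Qed.

Lemma proj1_act h a : proj 1 (act h a) = proj 1 a.
Proof. by rewrite proj_act conj1g act_centre //; apply: proj1_centre. Qed.

(** The trace is central, hence equal to its own image under [p_1], and
[p_1 (g a) = p_1 a] for each of the [n] elements [g]. *)
Lemma trace_proj1 a : trace a = proj 1 a *+ #|G|.
Proof.
have /centre_twisted tr1 := trace_centre a.
have := proj_of_twisted 1 tr1; rewrite eqxx => <-.
rewrite proj_sum -sumr_const; apply: eq_bigr => g _; exact: proj1_act.
Qed.

(** Among the components [u p_h(b)], which lie in [J_{hg}], only the one with
[hg = 1] survives under [p_1]. *)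
Lemma proj1_mul g u b : twisted g u -> proj 1 (u * b) = u * proj g^-1 b.
Proof.
move=> ug; rewrite -{1}(sum_proj b) mulr_sumr proj_sum (bigD1 g^-1%g) //=.
have ubT h : twisted (h * g) (u * proj h b).
  exact: twistedM ug (@proj_twisted _ _).
rewrite (proj_of_twisted _ (ubT _)) mulVg eqxx big1 ?addr0 // => h neq.
rewrite (proj_of_twisted _ (ubT _)) -(inj_eq (mulIg g^-1%g)) mul1g mulgK.
by rewrite eq_sym (negPf neq).
Qed.

(** Apply [p_g] to the dual basis formula: its coefficients
[tr(u x_i) = n u p_{g^-1}(x_i)] are central.  The products
[n p_{g^-1}(x_i) p_g(y_i)] are central elements whose sum acts as the identity on
[J_g]. *)
Lemma twisted_expand g u : twisted g u ->
  u = \sum_(p <- tens_repr X) u * (proj g^-1 p.1 * proj g p.2 *+ #|G|).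
Proof.
move=> ug; have := proj_of_twisted g ug; rewrite eqxx => {1}<-.
rewrite -{1}(sum_trace u) proj_sum; apply: eq_bigr => p _.
rewrite proj_mulc; last exact: trace_centre.
by rewrite trace_proj1 (proj1_mul _ ug) mulrnAl mulrnAr mulrA.
Qed.

(** Let [w = u - g(u)], and let [e = n x v], with [x] in [J_{g^-1}] and [v] in
[J_g], be one of the central elements of [twisted_expand].  Then [e u = c v] with
[c = n u x] central, so that [e w = c (v - g(v))], because [g] fixes the centre.
As [v v = v g(v)], a second factor [e] kills this, and [w = 0] by
[sum_annihilated_eq0]. *)
Lemma act_twisted g u : twisted g u -> act g u = u.
Proof.
pose sg (p : A * A) : A := proj g^-1 p.1 * proj g p.2 *+ #|G|.
have sgc p : centre (sg p).
  move=> y; rewrite mulrnAr mulrnAl; congr (_ *+ _).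
  apply: (centre_twisted _).1; rewrite -(mulgV g).
  exact: twistedM (@proj_twisted _ _) (@proj_twisted _ _).
move=> ug; apply/esym/subr0_eq.
set w := u - act g u.
have wg : twisted g w.
  by apply: (twistedB ug); have := twisted_act g ug; rewrite mulgK.
apply: (@sum_annihilated_eq0 _ (map sg (tens_repr X))).
- by move=> a b _ /mapP[p _ ->]; exact: sgc.
- move=> a /mapP[[x y] _ ->{a}] /=; set e := sg _.
  pose v := proj g y; pose c := (u * proj g^-1 x) *+ #|G|.
  have vg : twisted g v by exact: proj_twisted.
  have cc : centre c.
    move=> z; rewrite mulrnAr mulrnAl; congr (_ *+ _).
    by rewrite -(proj1_mul _ ug); apply: proj1_centre.
  have ue : e * u = c * v by rewrite -sgc /e /sg /c mulrnAl mulrnAr mulrA.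
  have -> : e * w = c * (v - act g v).
    have ec : act g e = e by apply: act_centre; apply: sgc.
    by rewrite !mulrBr ue -{1}ec -rmorphM ue rmorphM (act_centre _ cc).
  rewrite mulrA cc -mulrA /e /sg mulrnAl -mulrA -/v.
  by rewrite mulrBr (vg v) subrr mulr0 mul0rn mulr0.
- rewrite big_map {1}(twisted_expand wg); apply: eq_bigr => p _; exact: sgc.
Qed.

(** Compare coordinates: at [g] they are [p_g(s)] and [p_g(g(s)) = g(p_g(s))],
and [g] is the identity on the values of [p_g]. *)
Lemma galois_flip s : X * pt s 1 = pt 1 s * X.
Proof.
have coord_tail g Z :
    coord g (pt 1 s * Z) = coord g (Z * pt (act g s) 1).
  elim/apure_ind: Z => [|x y Z IHZ]; first by rewrite mulr0 mul0r.
  rewrite mulrDr mulrDl !coordD IHZ; congr (_ + _).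
  by rewrite !apureM !coord_apure mul1r mulr1 rmorphM mulrA.
apply: coord_inj => g; rewrite coord_tail !coord_proj proj_act.
by rewrite conjgE mulKg act_twisted //; apply: proj_twisted.
Qed.

Lemma sum_galois1 : \sum_(p <- tens_repr X) p.1 * p.2 = 1.
Proof.
have := sum_galois 1; rewrite eqxx => <-.
by apply: eq_bigr => p _; rewrite act1.
Qed.

Lemma proj1E a : proj 1 a = \sum_(p <- tens_repr X) p.1 * a * p.2.
Proof. by apply: eq_bigr => p _; rewrite act1. Qed.

Lemma apure_suml (r : seq (A * A)) (F : A * A -> A) y :
  pt (\sum_(p <- r) F p) y = \sum_(p <- r) pt (F p) y.
Proof.
elim: r => [|p r IHr]; last by rewrite !big_cons apureDl IHr.
by rewrite !big_nil; apply: (addrI (apure 0 y)); rewrite -apureDl !addr0.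
Qed.

Lemma apure_sumr (r : seq (A * A)) (F : A * A -> A) x :
  pt x (\sum_(p <- r) F p) = \sum_(p <- r) pt x (F p).
Proof.
elim: r => [|p r IHr]; last by rewrite !big_cons apureDr IHr.
by rewrite !big_nil; apply: (addrI (apure x 0)); rewrite -apureDr !addr0.
Qed.

(** If [Z] commutes with the [s (x) 1], then [Z] is equal to the sum of the
[(x_i (x) 1) Z (y_i (x) 1)], because the [x_i y_i] have sum [1].  This is the image
of [Z] under [p_1 (x) 1], and [p_1] has values in the base ring, which can be
moved to the second factor. *)
Lemma commutant_left Z :
  (forall s, pt s 1 * Z = Z * pt s 1) ->
  exists t, Z = apure 1 t.
Proof.
move=> Zc.
have -> : Z = \sum_(p <- tens_repr X) pt p.1 1 * Z * pt p.2 1.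
  under eq_bigr do rewrite Zc -mulrA apureM mulr1.
  by rewrite -mulr_sumr -apure_suml sum_galois1 mulr1.
elim/apure_ind: Z {Zc} => [|x y Z [t IHZ]].
  exists 0; rewrite big1 => [|p _]; last by rewrite mulr0 mul0r.
  by apply: (addrI (apure 1 0)); rewrite -apureDr !addr0.
have [r r_x] := centre_base (proj1_centre x).
exists (alg_map A r * y + t); rewrite apureDr -IHZ.
rewrite -apure_bal mul1r r_x proj1E apure_suml -big_split.
apply: eq_bigr => p _ /=; rewrite mulrDr mulrDl; congr (_ + _).
by rewrite !apureM mulr1 mul1r.
Qed.

(** The averaging argument of [commutant_left], repeated in the second factor. *)
Lemma tensor_centre Z :
  (forall s, pt s 1 * Z = Z * pt s 1) ->
  (forall s, pt 1 s * Z = Z * pt 1 s) ->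
  exists r, Z = alg_map (tpow A 1) r.
Proof.
move=> /commutant_left[t ->] tc.
have [r r_t] := centre_base (proj1_centre t).
exists r; rewrite [RHS]amapE r_t proj1E apure_sumr.
transitivity (pt 1 t * apure 1 (\sum_(p <- tens_repr X) p.1 * p.2)).
  by rewrite sum_galois1 mulr1.
rewrite apure_sumr mulr_sumr; apply: eq_bigr => p _.
have := congr1 (fun Z => Z * pt 1 p.2) (tc p.1).
by rewrite /= !apureM !mulr1 mulrA => ->.
Qed.

Lemma galois_square_central :
  exists r, X * X = alg_map (tpow A 1) r.
Proof.
apply: tensor_centre => s.
  by rewrite mulrA galois_casimir -mulrA -galois_flip mulrA.
by rewrite mulrA -galois_flip -!mulrA -galois_casimir.
Qed.

(** At the neutral element the coordinate of [X X] is the sum of the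
[p_1(x_i) y_i]; by [trace_proj1], [n] times this is the dual basis formula
for [1]. *)
Lemma galois_square_scalar r :
  X * X = alg_map (tpow A 1) r -> alg_map A r *+ #|G| = 1.
Proof.
move=> /(congr1 (coord 1)); rewrite coord_apure rmorph1 mulr1 => <-.
rewrite -[RHS]sum_trace.
transitivity ((\sum_(p <- tens_repr X) proj 1 p.1 * p.2) *+ #|G|); last first.
  rewrite -sumrMnl; apply: eq_bigr => p _.
  by rewrite mul1r trace_proj1 mulrnAl.
congr (_ *+ _).
rewrite {2}(tens_sumE X).
elim: (tens_repr X) => [|p s IHs]; first by rewrite !big_nil mulr0 coord0.
rewrite !big_cons mulrDr coordD IHs; congr (_ + _).
have -> : pure _ _ p.1 p.2 = pt p.1 1 * pt 1 p.2.
  by rewrite apureM mulr1 mul1r.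
by rewrite mulrA coord_mulr coord_proj act1.
Qed.

Lemma galois_element_unit : exists Y, X * Y = 1 /\ Y * X = 1.
Proof.
have [r X2] := galois_square_central; have nr := galois_square_scalar X2.
have nX2 : X * X *+ #|G| = 1.
  rewrite X2 -(rmorphMn (alg_map (tpow A 1))).
  rewrite -[LHS]/(pt (alg_map A (r *+ #|G|)) 1).
  by rewrite rmorphMn nr.
by exists (X *+ #|G|); rewrite mulrnAr mulrnAl.
Qed.

End Central.
End GaloisAlgebra.

Theorem proposition2p7 (k : comPzRingType) (R S : algebra k)
    (psi : {rmorphism R -> S})
    (psi_k : forall c : k, psi (alg_map R c) = alg_map S c)
    (G : finGroupType) (act : G -> {rmorphism S -> S}) :
  (forall H : centralizing_galois psi act,
    let A : algebra R := Algebra (cgalois_central H) in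
    let X : tpow A 1 := galois_element psi act in
    let X12 := leg 2 0 1 X in
    let X23 := leg 2 1 2 X in
    let X13 := leg 2 0 2 X in
    [/\ X12 * X23 = X23 * X13,
        X23 * X13 = X13 * X12 &
        X12 * X23 * X12 = X23 * X12 * X23])
  /\
  (forall H : galois_azumaya psi act,
    let A : algebra R := Algebra (gazumaya_central H) in
    let X : tpow A 1 := galois_element psi act in
    (exists Y : tpow A 1, X * Y = 1 /\ Y * X = 1) /\
    forall n : nat, (2 <= n)%N ->
      exists rho : {multiplicative braid n -> mod_aut (tpow A n.-1)},
        forall (i : 'I_n.-1) (x : tpow A n.-1),
          rho (sigma i) x = leg n.-1 i i.+1 X * x).
Proof.
split=> [H A X X12 X23 X13|H A X].
  have cX : casimir X := @galois_casimir _ A _ _ (cgalois_galois H).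
  split; first exact: casimir_frobenius_left.
    exact: casimir_frobenius_right.
  exact: casimir_yang_baxter.
have galA : galois_extension (alg_map A) act := gazumaya_galois H.
have cX : casimir X := galois_casimir galA.
have centre_base (z : A) : centre z -> exists r, alg_map A r = z.
  by move=> zc; apply: (azumaya_center (gazumaya_azumaya H)).
have [Y [XY YX]] := galois_element_unit galA centre_base.
split; first by exists Y.
by move=> n _; apply: casimir_braid_representation cX XY YX n.
Qed.
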